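(* Let $P_1, P_2$ be closed and guarded synchronization-free ITMPC process terms (i.e., every occurrence of the parallel composition operator in them has empty synchronization set). Then \[ P_1 \sim_{\mathrm{MB,it}} P_2 \iff \Gamma_{\mathrm{mp}}[\![P_1]\!] \sim_{\mathrm{MB,ot,mp}} \Gamma_{\mathrm{mp}}[\![P_2]\!]. \]
   Context: Notation. Let $\mathit{Name}_{\mathrm v}$ be a set of visible action names, $\tau\notin\mathit{Name}_{\mathrm v}$ the internal action, and $\mathit{Name}=\mathit{Name}_{\mathrm v}\cup\{\tau\}$. $\mathit{Relab}$ is a set of relabeling functions $\varphi:\mathit{Name}\to\mathit{Name}$ with $\varphi^{-1}(\tau)=\{\tau\}$; $\mathit{Var}$ is a set of process variables. Fix an associative and commutative binary operation $\otimes$ on $\mathbb{R}_{>0}$. ITMPC (integrated-time Markovian process calculus). Terms: $P ::= \underline{0} \mid \langle a,\lambda\rangle . P \mid P+P \mid P \parallel_S P \mid P/H \mid P[\varphi] \mid X \mid \mathrm{rec}\,X:P$ with $a\in\mathit{Name}$, $\lambda\in\mathbb{R}_{>0}$, $S,H\subseteq\mathit{Name}_{\mathrm v}$, $\varphi\in\mathit{Relab}$, $X\in\mathit{Var}$. $\mathbb{P}_{\mathrm{M,it}}$ is the set of closed and guarded terms. The transition relation $P\xrightarrow{a,\lambda}P'$ is a multiset (each transition counted with the number of its distinct derivations) generated by the rules: $\langle a,\lambda\rangle.P\xrightarrow{a,\lambda}P$; if $P_1\xrightarrow{a,\lambda}P'$ then $P_1+P_2\xrightarrow{a,\lambda}P'$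 and $P_2+P_1\xrightarrow{a,\lambda}P'$; if $P_1\xrightarrow{a,\lambda}P_1'$ and $a\notin S$ then $P_1\parallel_S P_2\xrightarrow{a,\lambda}P_1'\parallel_S P_2$ (symmetrically for the right operand); if $P_1\xrightarrow{a,\lambda_1}P_1'$, $P_2\xrightarrow{a,\lambda_2}P_2'$, $a\in S$ then $P_1\parallel_S P_2\xrightarrow{a,\lambda_1\otimes\lambda_2}P_1'\parallel_S P_2'$; if $P\xrightarrow{a,\lambda}P'$ then $P/H\xrightarrow{\tau,\lambda}P'/H$ when $a\in H$ and $P/H\xrightarrow{a,\lambda}P'/H$ when $a\notin H$; if $P\xrightarrow{a,\lambda}P'$ then $P[\varphi]\xrightarrow{\varphi(a),\lambda}P'[\varphi]$; if $P\{\mathrm{rec}\,X:P\hookrightarrow X\}\xrightarrow{a,\lambda}P'$ then $\mathrm{rec}\,X:P\xrightarrow{a,\lambda}P'$. Define $\mathit{rate}_{\mathrm{it}}(P,a,D)=\sum\{\!|\lambda \mid \exists P'\in D.\,P\xrightarrow{a,\lambda}P'|\!\}$ (multiset sum, $0$ if empty). An equivalence relation $\mathcal B$ on $\mathbb{P}_{\mathrm{M,it}}$ is an integrated-time Markovian bisimulation if for all $(P_1,P_2)\in\mathcal B$, all $a\in\mathit{Name}$ and all $D\in\mathbb{P}_{\mathrm{M,it}}/\mathcal B$: $\mathit{rate}_{\mathrm{it}}(P_1,a,D)=\mathit{rate}_{\mathrm{it}}(P_2,a,D)$. $\sim_{\mathrm{MB,it}}$ is the union of all such bisimulations. OTMPC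 (orthogonal-time Markovian process calculus). Terms: $Q ::= \underline{0} \mid a.Q \mid (\lambda).Q \mid Q+Q \mid Q\parallel_S Q \mid Q/H \mid Q[\varphi] \mid X \mid \mathrm{rec}\,X:Q$ (same parameter ranges); $\mathbb{P}_{\mathrm{M,ot}}$ is the set of closed guarded terms. Action transitions $Q\xrightarrow{a}Q'$ form a set generated by: $a.Q\xrightarrow{a}Q$; choice rules for $+$ on both sides; interleaving of the left/right operand of $\parallel_S$ for $a\notin S$; $Q_1\parallel_S Q_2\xrightarrow{a}Q_1'\parallel_S Q_2'$ if both operands do $a$ and $a\in S$; hiding ($a\in H$ becomes $\tau$, otherwise unchanged), relabeling ($a$ becomes $\varphi(a)$), and recursion unfolding as in ITMPC. Time transitions $Q\xrightarrow{\lambda}_{\mathrm M}Q'$ form a multiset (with derivation multiplicities) generated by: $(\lambda).Q\xrightarrow{\lambda}_{\mathrm M}Q$; choice rules for $+$ on both sides; $Q_1\parallel_S Q_2$ lets either operand perform a time transition independently (no synchronization on time, for any $S$); hiding, relabeling and recursion propagate time transitions unchanged. Define $\mathit{rate}_{\mathrm{ot}}(Q,D)=\sum\{\!|\lambda\mid\exists Q'\in D.\,Q\xrightarrow{\lambda}_{\mathrm M}Q'|\!\}$. An equivalence relation $\mathcal B$ on $\mathbb{P}_{\mathrm{M,ot}}$ is a maximal-progress orthogonal-time Markovian bisimulation if for all $(Q_1,Q_2)\in\mathcal B$: for all $a\in\mathit{Name}$, whenever $Q_1\xrightarrow{a}Q_1'$ then $Q_2\xrightarrow{a}Q_2'$ with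 $(Q_1',Q_2')\in\mathcal B$, and vice versa; and, whenever neither $Q_1$ nor $Q_2$ can perform any $\tau$-action transition, $\mathit{rate}_{\mathrm{ot}}(Q_1,D)=\mathit{rate}_{\mathrm{ot}}(Q_2,D)$ for all $D\in\mathbb{P}_{\mathrm{M,ot}}/\mathcal B$. $\sim_{\mathrm{MB,ot,mp}}$ is the union of all maximal-progress orthogonal-time Markovian bisimulations. Translation $\Gamma_{\mathrm{mp}}$ from synchronization-free ITMPC terms to OTMPC terms, by structural induction: $\Gamma_{\mathrm{mp}}[\![\underline 0]\!]=\underline 0$; $\Gamma_{\mathrm{mp}}[\![\langle a,\lambda\rangle.P]\!]=(\lambda).\mathrm{rec}\,Z:(\tau.Z+a.\Gamma_{\mathrm{mp}}[\![P]\!])$ with $Z$ a variable not free in $P$; $\Gamma_{\mathrm{mp}}[\![P_1+P_2]\!]=\Gamma_{\mathrm{mp}}[\![P_1]\!]+\Gamma_{\mathrm{mp}}[\![P_2]\!]$; $\Gamma_{\mathrm{mp}}[\![P_1\parallel_\emptyset P_2]\!]=\Gamma_{\mathrm{mp}}[\![P_1]\!]\parallel_\emptyset\Gamma_{\mathrm{mp}}[\![P_2]\!]$; $\Gamma_{\mathrm{mp}}[\![P/H]\!]=\Gamma_{\mathrm{mp}}[\![P]\!]/H$; $\Gamma_{\mathrm{mp}}[\![P[\varphi]]\!]=\Gamma_{\mathrm{mp}}[\![P]\!][\varphi]$; $\Gamma_{\mathrm{mp}}[\![X]\!]=X$; $\Gamma_{\mathrm{mp}}[\![\mathrm{rec}\,X:P]\!]=\mathrm{rec}\,X:\Gamma_{\mathrm{mp}}[\![P]\!]$.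 *)

(* Defs.v *)
From HB Require Import structures.
From mathcomp Require Import all_boot all_order all_algebra.
From mathcomp Require Import interval_inference.
From mathcomp Require Import boolp classical_sets reals constructive_ereal esum.

Set Implicit Arguments.
Unset Strict Implicit.
Unset Printing Implicit Defensive.

Local Open Scope ring_scope.
Local Open Scope classical_set_scope.

(* Integrated-time (ITMPC) and orthogonal-time (OTMPC) Markovian process
   calculi, their Markovian bisimilarities, and the translation Gamma_mp. *)

(* Names are the visible names extended with the internal action; a set
   L : set V of visible names is seen as the set of names Some @` L. *)
Definition name (V : Type) : Type := option V.
Definition tau {V : Type} : name V := None.

Definition equivalence_on (T : Type) (A : set T) (B : T -> T -> Prop) : Prop :=
  [/\ forall x y, B x y -> A x /\ A y,
      forall x, A x -> B x x,
      forall x y, B x y -> B y x &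
      forall x y z, B x y -> B y z -> B x z].

Definition quotient_set (T : Type) (A : set T) (B : T -> T -> Prop) :
  set (set T) := [set [set y | B x y] | x in A].

Section Calculi.
Variables (R : realType) (V : Type) (Var : eqType).
Variable Relab : set (name V -> name V).

Inductive iterm : Type :=
| INil
| IPre of name V & {posnum R} & iterm
| ISum of iterm & iterm
| IPar of set V & iterm & iterm
| IHide of iterm & set V
| IRel of iterm & Relab
| IVar of Var
| IRec of Var & iterm.

(* Free variables. *)
Fixpoint ifv (P : iterm) : seq Var :=
  match P with
  | INil => [::]
  | IPre _ _ P1 => ifv P1
  | ISum P1 P2 => ifv P1 ++ ifv P2
  | IPar _ P1 P2 => ifv P1 ++ ifv P2
  | IHide P1 _ => ifv P1
  | IRel P1 _ => ifv P1
  | IVar X => [:: X]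
  | IRec X P1 => [seq Y <- ifv P1 | Y != X]
  end.

(* Variables with a free occurrence that is not in the scope of a prefix. *)
Fixpoint iufv (P : iterm) : seq Var :=
  match P with
  | INil => [::]
  | IPre _ _ _ => [::]
  | ISum P1 P2 => iufv P1 ++ iufv P2
  | IPar _ P1 P2 => iufv P1 ++ iufv P2
  | IHide P1 _ => iufv P1
  | IRel P1 _ => iufv P1
  | IVar X => [:: X]
  | IRec X P1 => [seq Y <- iufv P1 | Y != X]
  end.

(* In every subterm rec X : P, each free occurrence of X in P lies in the
   scope of a prefix of P. *)
Fixpoint iguarded (P : iterm) : bool :=
  match P with
  | INil => true
  | IPre _ _ P1 => iguarded P1
  | ISum P1 P2 => iguarded P1 && iguarded P2
  | IPar _ P1 P2 => iguarded P1 && iguarded P2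
  | IHide P1 _ => iguarded P1
  | IRel P1 _ => iguarded P1
  | IVar _ => true
  | IRec X P1 => (X \notin iufv P1) && iguarded P1
  end.

Definition iproc : set iterm := [set P | ifv P = [::] /\ iguarded P].

(* No renaming of bound variables is needed: in the transitions of a closed
   term only closed terms are ever substituted. *)
Fixpoint isubst (X : Var) (N P : iterm) : iterm :=
  match P with
  | INil => INil
  | IPre a l P1 => IPre a l (isubst X N P1)
  | ISum P1 P2 => ISum (isubst X N P1) (isubst X N P2)
  | IPar L P1 P2 => IPar L (isubst X N P1) (isubst X N P2)
  | IHide P1 H => IHide (isubst X N P1) H
  | IRel P1 phi => IRel (isubst X N P1) phi
  | IVar Y => if Y == X then N else IVar Y
  | IRec Y P1 => if Y == X then IRec Y P1 else IRec Y (isubst X N P1)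
  end.

Fixpoint sync_free (P : iterm) : Prop :=
  match P with
  | INil => True
  | IPre _ _ P1 => sync_free P1
  | ISum P1 P2 => sync_free P1 /\ sync_free P2
  | IPar L P1 P2 => [/\ L = set0, sync_free P1 & sync_free P2]
  | IHide P1 _ => sync_free P1
  | IRel P1 _ => sync_free P1
  | IVar _ => True
  | IRec _ P1 => sync_free P1
  end.

(* Terms of type [ider P a l P'] are the derivations of the transition from P
   to P' labelled a, l; the multiplicity of that transition is their number.
   The side conditions on names are propositions, hence proof irrelevant, and
   do not affect this number. *)
Section ITSemantics.
Variable otimes : {posnum R} -> {posnum R} -> {posnum R}.

Inductive ider : iterm -> name V -> {posnum R} -> iterm -> Type :=
| ider_pre a l P : ider (IPre a l P) a l P
| ider_suml P1 P2 a l P' : ider P1 a l P' -> ider (ISum P1 P2) a l P'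
| ider_sumr P1 P2 a l P' : ider P2 a l P' -> ider (ISum P1 P2) a l P'
| ider_parl L P1 P2 a l P1' : ~ (Some @` L) a ->
    ider P1 a l P1' -> ider (IPar L P1 P2) a l (IPar L P1' P2)
| ider_parr L P1 P2 a l P2' : ~ (Some @` L) a ->
    ider P2 a l P2' -> ider (IPar L P1 P2) a l (IPar L P1 P2')
| ider_sync L P1 P2 a l1 l2 P1' P2' : (Some @` L) a ->
    ider P1 a l1 P1' -> ider P2 a l2 P2' ->
    ider (IPar L P1 P2) a (otimes l1 l2) (IPar L P1' P2')
| ider_hide_in P H a l P' : (Some @` H) a ->
    ider P a l P' -> ider (IHide P H) tau l (IHide P' H)
| ider_hide_out P H a l P' : ~ (Some @` H) a ->
    ider P a l P' -> ider (IHide P H) a l (IHide P' H)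
| ider_rel P (phi : Relab) a l P' :
    ider P a l P' -> ider (IRel P phi) (val phi a) l (IRel P' phi)
| ider_unfold X P a l P' :
    ider (isubst X (IRec X P) P) a l P' -> ider (IRec X P) a l P'.

Record itrans (P : iterm) (a : name V) : Type := ITrans {
  itrate : {posnum R};
  ittarget : iterm;
  itder : ider P a itrate ittarget }.

HB.instance Definition _ P a := gen_eqMixin (itrans P a).
HB.instance Definition _ P a := gen_choiceMixin (itrans P a).

(* Possibly infinite sum of nonnegative terms; on closed guarded terms it has
   finitely many terms and a finite value. *)
Definition irate (P : iterm) (a : name V) (D : set iterm) : \bar R :=
  (\esum_(t in [set t : itrans P a | D (ittarget t)]) ((itrate t)%:num)%:E)%E.

Definition imbisim (B : iterm -> iterm -> Prop) : Prop :=
  equivalence_on iproc B /\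
  forall P1 P2, B P1 P2 ->
    forall (a : name V) (D : set iterm), quotient_set iproc B D ->
      irate P1 a D = irate P2 a D.

Definition imbisimilar (P1 P2 : iterm) : Prop :=
  exists2 B, imbisim B & B P1 P2.

End ITSemantics.

Inductive oterm : Type :=
| ONil
| OAct of name V & oterm
| OTime of {posnum R} & oterm
| OSum of oterm & oterm
| OPar of set V & oterm & oterm
| OHide of oterm & set V
| ORel of oterm & Relab
| OVar of Var
| ORec of Var & oterm.

Fixpoint ofv (Q : oterm) : seq Var :=
  match Q with
  | ONil => [::]
  | OAct _ Q1 => ofv Q1
  | OTime _ Q1 => ofv Q1
  | OSum Q1 Q2 => ofv Q1 ++ ofv Q2
  | OPar _ Q1 Q2 => ofv Q1 ++ ofv Q2
  | OHide Q1 _ => ofv Q1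
  | ORel Q1 _ => ofv Q1
  | OVar X => [:: X]
  | ORec X Q1 => [seq Y <- ofv Q1 | Y != X]
  end.

(* Both action prefixes and time prefixes are guards. *)
Fixpoint oufv (Q : oterm) : seq Var :=
  match Q with
  | ONil => [::]
  | OAct _ _ => [::]
  | OTime _ _ => [::]
  | OSum Q1 Q2 => oufv Q1 ++ oufv Q2
  | OPar _ Q1 Q2 => oufv Q1 ++ oufv Q2
  | OHide Q1 _ => oufv Q1
  | ORel Q1 _ => oufv Q1
  | OVar X => [:: X]
  | ORec X Q1 => [seq Y <- oufv Q1 | Y != X]
  end.

Fixpoint oguarded (Q : oterm) : bool :=
  match Q with
  | ONil => true
  | OAct _ Q1 => oguarded Q1
  | OTime _ Q1 => oguarded Q1
  | OSum Q1 Q2 => oguarded Q1 && oguarded Q2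
  | OPar _ Q1 Q2 => oguarded Q1 && oguarded Q2
  | OHide Q1 _ => oguarded Q1
  | ORel Q1 _ => oguarded Q1
  | OVar _ => true
  | ORec X Q1 => (X \notin oufv Q1) && oguarded Q1
  end.

Definition oproc : set oterm := [set Q | ofv Q = [::] /\ oguarded Q].

Fixpoint osubst (X : Var) (N Q : oterm) : oterm :=
  match Q with
  | ONil => ONil
  | OAct a Q1 => OAct a (osubst X N Q1)
  | OTime l Q1 => OTime l (osubst X N Q1)
  | OSum Q1 Q2 => OSum (osubst X N Q1) (osubst X N Q2)
  | OPar L Q1 Q2 => OPar L (osubst X N Q1) (osubst X N Q2)
  | OHide Q1 H => OHide (osubst X N Q1) H
  | ORel Q1 phi => ORel (osubst X N Q1) phi
  | OVar Y => if Y == X then N else OVar Y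
  | ORec Y Q1 => if Y == X then ORec Y Q1 else ORec Y (osubst X N Q1)
  end.

Inductive oact : oterm -> name V -> oterm -> Prop :=
| oact_pre a Q : oact (OAct a Q) a Q
| oact_suml Q1 Q2 a Q' : oact Q1 a Q' -> oact (OSum Q1 Q2) a Q'
| oact_sumr Q1 Q2 a Q' : oact Q2 a Q' -> oact (OSum Q1 Q2) a Q'
| oact_parl L Q1 Q2 a Q1' : ~ (Some @` L) a ->
    oact Q1 a Q1' -> oact (OPar L Q1 Q2) a (OPar L Q1' Q2)
| oact_parr L Q1 Q2 a Q2' : ~ (Some @` L) a ->
    oact Q2 a Q2' -> oact (OPar L Q1 Q2) a (OPar L Q1 Q2')
| oact_sync L Q1 Q2 a Q1' Q2' : (Some @` L) a ->
    oact Q1 a Q1' -> oact Q2 a Q2' -> oact (OPar L Q1 Q2) a (OPar L Q1' Q2')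
| oact_hide_in Q H a Q' : (Some @` H) a ->
    oact Q a Q' -> oact (OHide Q H) tau (OHide Q' H)
| oact_hide_out Q H a Q' : ~ (Some @` H) a ->
    oact Q a Q' -> oact (OHide Q H) a (OHide Q' H)
| oact_rel Q (phi : Relab) a Q' :
    oact Q a Q' -> oact (ORel Q phi) (val phi a) (ORel Q' phi)
| oact_unfold X Q a Q' :
    oact (osubst X (ORec X Q) Q) a Q' -> oact (ORec X Q) a Q'.

(* Derivations of time transitions, counted as in [ider]. *)
Inductive oder : oterm -> {posnum R} -> oterm -> Type :=
| oder_pre l Q : oder (OTime l Q) l Q
| oder_suml Q1 Q2 l Q' : oder Q1 l Q' -> oder (OSum Q1 Q2) l Q'
| oder_sumr Q1 Q2 l Q' : oder Q2 l Q' -> oder (OSum Q1 Q2) l Q'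
| oder_parl L Q1 Q2 l Q1' :
    oder Q1 l Q1' -> oder (OPar L Q1 Q2) l (OPar L Q1' Q2)
| oder_parr L Q1 Q2 l Q2' :
    oder Q2 l Q2' -> oder (OPar L Q1 Q2) l (OPar L Q1 Q2')
| oder_hide Q H l Q' : oder Q l Q' -> oder (OHide Q H) l (OHide Q' H)
| oder_rel Q (phi : Relab) l Q' :
    oder Q l Q' -> oder (ORel Q phi) l (ORel Q' phi)
| oder_unfold X Q l Q' :
    oder (osubst X (ORec X Q) Q) l Q' -> oder (ORec X Q) l Q'.

Record otrans (Q : oterm) : Type := OTrans {
  otrate : {posnum R};
  ottarget : oterm;
  otder : oder Q otrate ottarget }.

HB.instance Definition _ Q := gen_eqMixin (otrans Q).
HB.instance Definition _ Q := gen_choiceMixin (otrans Q).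

Definition orate (Q : oterm) (D : set oterm) : \bar R :=
  (\esum_(t in [set t : otrans Q | D (ottarget t)]) ((otrate t)%:num)%:E)%E.

Definition ombisim_mp (B : oterm -> oterm -> Prop) : Prop :=
  equivalence_on oproc B /\
  forall Q1 Q2, B Q1 Q2 ->
    [/\ forall a Q1', oact Q1 a Q1' -> exists2 Q2', oact Q2 a Q2' & B Q1' Q2',
        forall a Q2', oact Q2 a Q2' -> exists2 Q1', oact Q1 a Q1' & B Q1' Q2' &
        ~ (exists Q1', oact Q1 tau Q1') -> ~ (exists Q2', oact Q2 tau Q2') ->
        forall D : set oterm, quotient_set oproc B D ->
          orate Q1 D = orate Q2 D].

Definition ombisimilar_mp (Q1 Q2 : oterm) : Prop :=
  exists2 B, ombisim_mp B & B Q1 Q2.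

(* [fresh P] is the bound variable Z introduced in the image of a prefix
   <a, l>.P; it is meant not to be free in P. The translation is meant for
   synchronization-free terms, for which L is always empty below. *)
Fixpoint Gamma_mp (fresh : iterm -> Var) (P : iterm) : oterm :=
  match P with
  | INil => ONil
  | IPre a l P1 =>
      OTime l (ORec (fresh P1)
        (OSum (OAct tau (OVar (fresh P1))) (OAct a (Gamma_mp fresh P1))))
  | ISum P1 P2 => OSum (Gamma_mp fresh P1) (Gamma_mp fresh P2)
  | IPar L P1 P2 => OPar L (Gamma_mp fresh P1) (Gamma_mp fresh P2)
  | IHide P1 H => OHide (Gamma_mp fresh P1) H
  | IRel P1 phi => ORel (Gamma_mp fresh P1) phi
  | IVar X => OVar X
  | IRec X P1 => ORec X (Gamma_mp fresh P1)
  end.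

End Calculi.

(* Main.v *)
(* Up to the choice of the bound variables Z, the translation turns every
   transition P --a,l--> P' into a time transition to a context of
   rec Z : (tau.Z + a.G), where G translates P'. The only actions of this target
   are tau, back to itself, and a (possibly renamed or hidden), to G: it is
   "pending" on a. Translated terms themselves perform no action at all, so their
   rates always matter, while the rates of pending terms never do, thanks to
   their tau-loop. As derivations correspond bijectively, an integrated-time
   bisimulation extends to pending terms with equal names and related
   continuations; conversely two pending terms are bisimilar only if their names
   are equal and their continuations bisimilar. *)
Require Import Defs.
From mathcomp Require Import all_boot all_order all_algebra.
From mathcomp Require Import interval_inference.
From mathcomp Require Import boolp classical_sets reals.
From mathcomp Require Import constructive_ereal esum.
From Stdlib Require Import Program.Equality.

Set Implicit Arguments.
Unset Strict Implicit.
Unset Printing Implicit Defensive.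

Local Open Scope ring_scope.
Local Open Scope classical_set_scope.

(** * The image of the translation and its decoding *)

Section Translation.
Variables (R : realType) (V : Type) (Var : eqType).
Variable Relab : set (name V -> name V).
Local Notation iterm := (iterm R Var Relab).
Local Notation oterm := (oterm R Var Relab).
Implicit Types (P : iterm) (Q G K : oterm) (a b : name V) (l : {posnum R}).

(** Left inverse of the translation on synchronization-free terms: it forgets the loops and the
    variables [Z]. Where no pattern applies, [INil] is a mere placeholder. *)
Fixpoint unGamma (Q : oterm) : iterm :=
  match Q with
  | OTime l (ORec _ (OSum _ (OAct a G))) => IPre a l (unGamma G)
  | OSum Q1 Q2 => ISum (unGamma Q1) (unGamma Q2)
  | OPar L Q1 Q2 => IPar L (unGamma Q1) (unGamma Q2)
  | OHide Q1 H => IHide (unGamma Q1) H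
  | ORel Q1 phi => IRel (unGamma Q1) phi
  | OVar X => IVar R Relab X
  | ORec X Q1 => IRec X (unGamma Q1)
  | _ => INil R Var Relab
  end.

(* Holds of the terms obtained from synchronization-free terms by choosing the
   bound variable of each translated prefix arbitrarily among those not free in
   its continuation. Unlike the range of [Gamma_mp fresh], this set is closed
   under unfolding, as substitution need not preserve the choice of [fresh]. *)
Fixpoint Gamma_image (Q : oterm) : Prop :=
  match Q with
  | ONil => True
  | OTime _ (ORec Z (OSum (OAct None (OVar Y)) (OAct _ G))) =>
      [/\ Y = Z, Z \notin ofv G & Gamma_image G]
  | OSum Q1 Q2 => Gamma_image Q1 /\ Gamma_image Q2
  | OPar L Q1 Q2 => [/\ L = set0, Gamma_image Q1 & Gamma_image Q2]
  | OHide Q1 _ => Gamma_image Q1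
  | ORel Q1 _ => Gamma_image Q1
  | OVar _ => True
  | ORec _ Q1 => Gamma_image Q1
  | _ => False
  end.

Definition wait Z a G : oterm :=
  ORec Z (OSum (OAct tau (OVar R Relab Z)) (OAct a G)).

Lemma Gamma_image_time l Q : Gamma_image (OTime l Q) ->
  exists Z a G, [/\ Q = wait Z a G, Z \notin ofv G & Gamma_image G].
Proof.
case: Q => //= Z [] //= [] //= [] //= [] //= Y [] //= a G [-> ZG imG].
by exists Z, a, G.
Qed.

(** The continuation [G] lies several constructors below its time prefix, so structural induction on
    terms gives no hypothesis about it; the fixpoint recurses on [G] directly. *)
Lemma Gamma_image_ind (P : oterm -> Prop) :
  P (ONil R Var Relab) ->
  (forall l Z a G, Z \notin ofv G -> Gamma_image G -> P G ->
     P (OTime l (wait Z a G))) ->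
  (forall Q1 Q2, Gamma_image Q1 -> Gamma_image Q2 -> P Q1 -> P Q2 ->
     P (OSum Q1 Q2)) ->
  (forall Q1 Q2, Gamma_image Q1 -> Gamma_image Q2 -> P Q1 -> P Q2 ->
     P (OPar set0 Q1 Q2)) ->
  (forall Q H, Gamma_image Q -> P Q -> P (OHide Q H)) ->
  (forall Q phi, Gamma_image Q -> P Q -> P (ORel Q phi)) ->
  (forall X, P (OVar R Relab X)) ->
  (forall X Q, Gamma_image Q -> P Q -> P (ORec X Q)) ->
  forall Q, Gamma_image Q -> P Q.
Proof.
move=> P0 Ptime Psum Ppar Phide Prel Pvar Prec; fix IH 1.
case=> //= [l Q|Q1 Q2 [im1 im2]|L Q1 Q2 [-> im1 im2]|Q H im|Q phi im|X Q im].
- case: Q => //= Z [] //= [] //= [] //= [] //= Y [] //= a G [-> ZG imG].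
  by apply: Ptime => //; apply: IH.
- by apply: Psum => //; apply: IH.
- by apply: Ppar => //; apply: IH.
- by apply: Phide => //; apply: IH.
- by apply: Prel => //; apply: IH.
- by apply: Prec => //; apply: IH.
Qed.

Lemma ifv_unGamma Q : Gamma_image Q -> ifv (unGamma Q) = ofv Q.
Proof.
move: Q; apply: Gamma_image_ind => //=.
- move=> _ Z a G ZG _ ->; rewrite eqxx /=.
  by apply/esym/all_filterP/allP => Y YG; apply: contraNneq ZG => <-.
- by move=> Q1 Q2 _ _ -> ->.
- by move=> Q1 Q2 _ _ -> ->.
- by move=> X Q _ ->.
Qed.

Lemma iufv_unGamma Q : Gamma_image Q -> iufv (unGamma Q) = oufv Q.
Proof.
move: Q; apply: Gamma_image_ind => //=.
- by move=> Q1 Q2 _ _ -> ->.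
- by move=> Q1 Q2 _ _ -> ->.
- by move=> X Q _ ->.
Qed.

Lemma iguarded_unGamma Q : Gamma_image Q -> iguarded (unGamma Q) = oguarded Q.
Proof.
move: Q; apply: Gamma_image_ind => //=.
- by move=> Q1 Q2 _ _ -> ->.
- by move=> Q1 Q2 _ _ -> ->.
- by move=> X Q im ->; rewrite iufv_unGamma.
Qed.

Lemma iproc_unGamma Q : Gamma_image Q -> iproc (unGamma Q) = oproc Q.
Proof. by move=> im; rewrite /iproc /oproc /= ifv_unGamma// iguarded_unGamma. Qed.

Lemma sync_free_unGamma Q : Gamma_image Q -> sync_free (unGamma Q).
Proof. by move: Q; apply: Gamma_image_ind. Qed.

(** * Substitution, closedness and guardedness *)

Lemma isubst_notin X N P : X \notin ifv P -> isubst X N P = P.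
Proof.
elim: P => //=.
- by move=> a l P IH XP; rewrite IH.
- by move=> P1 IH1 P2 IH2; rewrite mem_cat => /norP[? ?]; rewrite IH1// IH2.
- by move=> L P1 IH1 P2 IH2; rewrite mem_cat => /norP[? ?]; rewrite IH1// IH2.
- by move=> P IH H XP; rewrite IH.
- by move=> P IH phi XP; rewrite IH.
- by move=> Y; rewrite mem_seq1 eq_sym => /negbTE ->.
- move=> Y P IH; rewrite mem_filter; case: eqVneq => //= _ XP.
  by rewrite IH.
Qed.

Lemma osubst_notin X N Q : X \notin ofv Q -> osubst X N Q = Q.
Proof.
elim: Q => //=.
- by move=> a Q IH XQ; rewrite IH.
- by move=> l Q IH XQ; rewrite IH.
- by move=> Q1 IH1 Q2 IH2; rewrite mem_cat => /norP[? ?]; rewrite IH1// IH2.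
- by move=> L Q1 IH1 Q2 IH2; rewrite mem_cat => /norP[? ?]; rewrite IH1// IH2.
- by move=> Q IH H XQ; rewrite IH.
- by move=> Q IH phi XQ; rewrite IH.
- by move=> Y; rewrite mem_seq1 eq_sym => /negbTE ->.
- move=> Y Q IH; rewrite mem_filter; case: eqVneq => //= _ XQ.
  by rewrite IH.
Qed.

Lemma ofv_osubst X N Q : ofv N = [::] ->
  ofv (osubst X N Q) = [seq Y <- ofv Q | Y != X].
Proof.
move=> N0; elim: Q => //=.
- by move=> Q1 -> Q2 ->; rewrite filter_cat.
- by move=> L Q1 -> Q2 ->; rewrite filter_cat.
- by move=> Y; case: eqVneq.
- move=> Y Q IH; case: (eqVneq Y X) => /= [<-|YX].
    by rewrite filter_id.
  by rewrite IH -!filter_predI; apply: eq_filter => W /=; rewrite andbC.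
Qed.

Lemma oufv_ofv Q : {subset oufv Q <= ofv Q}.
Proof.
elim: Q => //=.
- move=> Q1 IH1 Q2 IH2 X; rewrite !mem_cat.
  by case/orP => [/IH1|/IH2] ->; rewrite ?orbT.
- move=> L Q1 IH1 Q2 IH2 X; rewrite !mem_cat.
  by case/orP => [/IH1|/IH2] ->; rewrite ?orbT.
- by move=> X Y.
- by move=> X Q IH Y; rewrite !mem_filter => /andP[-> /IH].
Qed.

Lemma oufv_osubst X N Q : ofv N = [::] -> {subset oufv (osubst X N Q) <= oufv Q}.
Proof.
move=> N0; elim: Q => //=.
- move=> Q1 IH1 Q2 IH2 Y; rewrite !mem_cat.
  by case/orP => [/IH1|/IH2] ->; rewrite ?orbT.
- move=> L Q1 IH1 Q2 IH2 Y; rewrite !mem_cat.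
  by case/orP => [/IH1|/IH2] ->; rewrite ?orbT.
- by move=> Y; case: eqVneq => _ Z // /oufv_ofv; rewrite N0.
- move=> Y Q IH; case: eqVneq => _ Z //=.
  by rewrite !mem_filter => /andP[-> /IH].
Qed.

(** Since [N] is closed, inserting it creates no unguarded occurrence of a variable bound in [Q]. *)
Lemma oguarded_osubst X N Q : oproc N -> oguarded Q -> oguarded (osubst X N Q).
Proof.
move=> [N0 gN]; elim: Q => //=.
- by move=> Q1 IH1 Q2 IH2 /andP[/IH1 -> /IH2].
- by move=> L Q1 IH1 Q2 IH2 /andP[/IH1 -> /IH2].
- by move=> Y _; case: eqVneq.
- move=> Y Q IH /andP[YQ gQ]; case: eqVneq => [_|_] /=; first by rewrite YQ.
  by rewrite IH// andbT; apply: contra YQ; apply: oufv_osubst.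
Qed.

Lemma oproc_sum Q1 Q2 : oproc (OSum Q1 Q2) <-> oproc Q1 /\ oproc Q2.
Proof.
rewrite /oproc /=; split => [[/eqP]|[[-> ->] [-> ->]]//].
by rewrite -size_eq0 size_cat addn_eq0 !size_eq0 => /andP[/eqP-> /eqP->] /andP[].
Qed.

Lemma oproc_par L Q1 Q2 : oproc (OPar L Q1 Q2) <-> oproc Q1 /\ oproc Q2.
Proof. exact: oproc_sum. Qed.

Lemma oproc_unfold X Q : oproc (ORec X Q) -> oproc (osubst X (ORec X Q) Q).
Proof.
move=> pQ; have [Q0 /andP[_ gQ]] := pQ.
by split; [rewrite ofv_osubst|exact: oguarded_osubst].
Qed.

Lemma oproc_wait Z a G : Z \notin ofv G -> oproc (wait Z a G) <-> oproc G.
Proof.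
move=> ZG; rewrite /oproc /= eqxx /=.
suff -> : [seq Y <- ofv G | Y != Z] = ofv G by [].
by apply/all_filterP/allP => Y YG; apply: contraNneq ZG => <-.
Qed.

(** A closed [N] brings no free variable into the continuations, so each [Z] stays fresh for its
    own. *)
Lemma Gamma_image_osubst X N Q : ofv N = [::] -> Gamma_image N ->
  Gamma_image Q -> Gamma_image (osubst X N Q).
Proof.
move=> N0 imN; move: Q; apply: Gamma_image_ind => //=.
- move=> _ Z a G ZG imG IH; case: eqVneq => //= _.
  by split=> //; rewrite ofv_osubst// mem_filter (negbTE ZG) andbF.
- by move=> Y; case: eqVneq.
- by move=> Y Q imQ IH; case: eqVneq.
Qed.

(** Makes decoding commute with the unfolding of recursion. *)
Lemma unGamma_osubst X N Q : ofv N = [::] -> Gamma_image Q ->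
  unGamma (osubst X N Q) = isubst X (unGamma N) (unGamma Q).
Proof.
move=> N0; move: Q; apply: Gamma_image_ind => //=.
(* If [Z] is [X], [osubst] stops at the binder whereas [isubst] enters the continuation; as [X] is
   not free there, nothing changes either way. *)
- move=> l Z a G ZG imG IH; case: (eqVneq Z X) => /= [<-|_]; last by rewrite IH.
  by rewrite isubst_notin// ifv_unGamma.
- by move=> Q1 Q2 _ _ -> ->.
- by move=> Q1 Q2 _ _ -> ->.
- by move=> Q H _ ->.
- by move=> Q phi _ ->.
- by move=> Y; case: eqVneq.
- by move=> Y Q _ IH; case: eqVneq => //= _; rewrite IH.
Qed.

Lemma Gamma_image_unfold X Q : oproc (ORec X Q) -> Gamma_image Q ->
  Gamma_image (osubst X (ORec X Q) Q).
Proof. by move=> [Q0 _] imQ; apply: Gamma_image_osubst. Qed.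

Lemma Gamma_image_Gamma_mp fresh P : (forall P, fresh P \notin ifv P) ->
  sync_free P -> Gamma_image (Gamma_mp fresh P) /\ unGamma (Gamma_mp fresh P) = P.
Proof.
move=> freshP; elim: P => //=.
- move=> a l P IH /IH[im E]; split; last by rewrite E.
  by split=> //; rewrite -ifv_unGamma// E.
- by move=> P1 IH1 P2 IH2 [/IH1[? ->] /IH2[? ->]].
- by move=> L P1 IH1 P2 IH2 [-> /IH1[? ->] /IH2[? ->]].
- by move=> P IH H /IH[? ->].
- by move=> P IH phi /IH[? ->].
- by move=> X P IH /IH[? ->].
Qed.

(** * Actions of translated terms and of pending terms *)

(** In a translated term every action prefix sits under a time prefix, and unfolding keeps it so. *)
Lemma Gamma_image_noact Q a Q' : oproc Q -> Gamma_image Q -> ~ oact Q a Q'.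
Proof.
move=> + + d; elim: d => //=.
- by move=> Q1 Q2 {}a {}Q' _ IH /oproc_sum[/IH {}IH _] [/IH].
- by move=> Q1 Q2 {}a {}Q' _ IH /oproc_sum[_ /IH {}IH] [_ /IH].
- by move=> L Q1 Q2 {}a {}Q' _ _ IH /oproc_par[/IH {}IH _] [_ /IH].
- by move=> L Q1 Q2 {}a {}Q' _ _ IH /oproc_par[_ /IH {}IH] [_ _ /IH].
- by move=> L Q1 Q2 {}a Q1' Q2' _ _ IH _ _ /oproc_par[/IH {}IH _] [_ /IH].
- move=> X {}Q {}a {}Q' _ IH pQ imQ.
  by apply: IH; [exact: oproc_unfold|exact: Gamma_image_unfold].
Qed.

(** Specified by the exact set of actions of [K] instead of its syntax, so that parallel, hiding and
    relabeling contexts around a waiting term are treated uniformly. *)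
Definition pending K a G : Prop :=
  [/\ oproc K, oproc G, Gamma_image G &
      forall b K', oact K b K' <-> (b = tau /\ K' = K) \/ (b = a /\ K' = G)].

(** The loop on [K] and the step to [G] cannot be confused, even when [a] is [tau]: [K] performs an
    action and [G], being translated, performs none, so they differ. *)
Lemma pending_inj K a G b G' : pending K a G -> pending K b G' ->
  a = b /\ G = G'.
Proof.
move=> [pK pG imG actK] [_ pG' imG' actK'].
have K_neq H : oproc H -> Gamma_image H -> H <> K.
  move=> pH imH E; apply: (@Gamma_image_noact H tau K) => //.
  by rewrite {1}E; apply/actK; left.
have /actK' [[aE GE]|//] : oact K a G by apply/actK; right.
by case: (K_neq G).
Qed.

Lemma pending_not_image K a G : pending K a G -> ~ Gamma_image K.
Proof.
move=> [pK _ _ actK] imK; apply: (@Gamma_image_noact K tau K) => //.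
by apply/actK; left.
Qed.

Lemma pending_wait Z a G : oproc G -> Gamma_image G -> Z \notin ofv G ->
  pending (wait Z a G) a G.
Proof.
move=> pG imG ZG; have E : osubst Z (wait Z a G)
    (OSum (OAct tau (OVar R Relab Z)) (OAct a G)) =
    OSum (OAct tau (wait Z a G)) (OAct a G).
  by rewrite /= eqxx osubst_notin.
split => //; first exact/oproc_wait.
move=> b K'; split => [d|[[-> ->]|[-> ->]]].
- inversion d as [| | | | | | | | |? ? ? ? d']; subst.
  rewrite E in d'; inversion d' as [|? ? ? ? d''|? ? ? ? d''| | | | | | |]; subst.
    by inversion d''; subst; left.
  by inversion d''; subst; right.
- by apply: oact_unfold; rewrite E; apply: oact_suml; apply: oact_pre.
- by apply: oact_unfold; rewrite E; apply: oact_sumr; apply: oact_pre.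
Qed.

(** The other operand is translated, hence silent, and nothing synchronizes over the empty set. *)
Lemma pending_parl K a G Q : pending K a G -> oproc Q -> Gamma_image Q ->
  pending (OPar set0 K Q) a (OPar set0 G Q).
Proof.
move=> [pK pG imG actK] pQ imQ; split => //; [exact/oproc_par|exact/oproc_par|].
have n0 b : ~ ([set Some x | x in @set0 V]) b by rewrite image_set0.
move=> b K'; split => [d|].
- inversion d as [| | |? ? ? ? ? _ d'|? ? ? ? ? _ d'|? ? ? ? ? ? h| | | |]; subst.
  + by have [[-> ->]|[-> ->]] := (actK _ _).1 d'; [left|right].
  + by have := Gamma_image_noact pQ imQ d'.
  + by have := n0 _ h.
- by move=> [[-> ->]|[-> ->]]; apply: oact_parl => //; apply/actK; [left|right].
Qed.

Lemma pending_parr K a G Q : pending K a G -> oproc Q -> Gamma_image Q ->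
  pending (OPar set0 Q K) a (OPar set0 Q G).
Proof.
move=> [pK pG imG actK] pQ imQ; split => //; [exact/oproc_par|exact/oproc_par|].
have n0 b : ~ ([set Some x | x in @set0 V]) b by rewrite image_set0.
move=> b K'; split => [d|].
- inversion d as [| | |? ? ? ? ? _ d'|? ? ? ? ? _ d'|? ? ? ? ? ? h| | | |]; subst.
  + by have := Gamma_image_noact pQ imQ d'.
  + by have [[-> ->]|[-> ->]] := (actK _ _).1 d'; [left|right].
  + by have := n0 _ h.
- by move=> [[-> ->]|[-> ->]]; apply: oact_parr => //; apply/actK; [left|right].
Qed.

Definition hide_name (H : set V) a : name V :=
  if pselect ((Some @` H) a) then tau else a.

(** Only visible names are hidden, so the [tau]-loop is left as it is; [a] itself may turn into
    [tau]. *)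
Lemma pending_hide K a G H : pending K a G ->
  pending (OHide K H) (hide_name H a) (OHide G H).
Proof.
move=> [pK pG imG actK]; split => //.
have tauH : ~ (Some @` H) tau by case.
move=> b K'; rewrite /hide_name; split => [d|].
- inversion d as [| | | | | |? ? c ? h d'|? ? ? ? h d'| |]; subst.
  + have [[E _]|[E ->]] := (actK _ _).1 d'; first by rewrite E in h.
    by right; case: pselect; rewrite -E.
  + have [[-> ->]|[E ->]] := (actK _ _).1 d'; first by left.
    by right; case: pselect; rewrite -E.
- move=> [[-> ->]|[-> ->]].
    by apply: oact_hide_out => //; apply/actK; left.
  case: pselect => h; first by apply: (oact_hide_in h); apply/actK; right.
  by apply: oact_hide_out => //; apply/actK; right.
Qed.

Hypothesis Relab_tau : forall phi, Relab phi -> phi @^-1` [set tau] = [set tau].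

Lemma pending_rel K a G (phi : Relab) : pending K a G ->
  pending (ORel K phi) (val phi a) (ORel G phi).
Proof.
move=> [pK pG imG actK]; split => //.
have phi_tau : val phi tau = tau.
  have phiP : Relab (val phi) by apply/set_mem/(valP phi).
  by have : [set tau] (tau : name V) by []; rewrite -(Relab_tau phiP).
move=> b K'; split => [d|].
- inversion d as [| | | | | | | |? ? ? ? d'|]; subst.
  by have [[-> ->]|[-> ->]] := (actK _ _).1 d'; [left|right].
- move=> [[-> ->]|[-> ->]]; last by apply: oact_rel; apply/actK; right.
  by rewrite -{1}phi_tau; apply: oact_rel; apply/actK; left.
Qed.

End Translation.

(** * Derivations identified by their paths *)

Section Derivations.
Variables (R : realType) (V : Type) (Var : eqType).
Variable Relab : set (name V -> name V).
Variable otimes : {posnum R} -> {posnum R} -> {posnum R}.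
Local Notation iterm := (iterm R Var Relab).
Local Notation oterm := (oterm R Var Relab).
Local Notation ider := (@ider R V Var Relab otimes).
Local Notation oder := (@oder R V Var Relab).
Implicit Types (P : iterm) (Q G K : oterm) (a b : name V) (l : {posnum R}).

(* A derivation is determined by the choices made at binary operators (provided
   that no synchronization occurs). These paths match the derivations of the
   two calculi without any dependently typed bookkeeping. *)
Fixpoint ipath P a l P' (d : ider P a l P') : seq bool :=
  match d with
  | ider_pre _ _ _ => [::]
  | ider_suml _ _ _ _ _ d => true :: ipath d
  | ider_sumr _ _ _ _ _ d => false :: ipath d
  | ider_parl _ _ _ _ _ _ _ d => true :: ipath d
  | ider_parr _ _ _ _ _ _ _ d => false :: ipath d
  | ider_sync _ _ _ _ _ _ _ _ _ _ _ => [::]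
  | ider_hide_in _ _ _ _ _ _ d => ipath d
  | ider_hide_out _ _ _ _ _ _ d => ipath d
  | ider_rel _ _ _ _ _ d => ipath d
  | ider_unfold _ _ _ _ _ d => ipath d
  end.

Fixpoint opath Q l Q' (d : oder Q l Q') : seq bool :=
  match d with
  | oder_pre _ _ => [::]
  | oder_suml _ _ _ _ d => true :: opath d
  | oder_sumr _ _ _ _ d => false :: opath d
  | oder_parl _ _ _ _ _ d => true :: opath d
  | oder_parr _ _ _ _ _ d => false :: opath d
  | oder_hide _ _ _ _ d => opath d
  | oder_rel _ _ _ _ d => opath d
  | oder_unfold _ _ _ _ d => opath d
  end.

(** Heterogeneous equality of derivations from the same source: labels and targets are not known to
    agree beforehand, and identifying them is part of what path injectivity yields. *)
Variant isame P a l P' (d : ider P a l P') :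
    forall b m P'', ider P b m P'' -> Prop :=
  ISame : isame d d.

Variant osame Q l Q' (d : oder Q l Q') : forall m Q'', oder Q m Q'' -> Prop :=
  OSame : osame d d.

Lemma opath_inj Q l Q' (d : oder Q l Q') m Q'' (d' : oder Q m Q'') :
  opath d = opath d' -> osame d d'.
Proof.
elim: d m Q'' d'.
- by move=> {}l {}Q m Q'' d'; dependent destruction d'.
- move=> Q1 Q2 {}l {}Q' d IH m Q'' d'.
  by dependent destruction d' => //= -[/IH[]].
- move=> Q1 Q2 {}l {}Q' d IH m Q'' d'.
  by dependent destruction d' => //= -[/IH[]].
- move=> L Q1 Q2 {}l {}Q' d IH m Q'' d'.
  by dependent destruction d' => //= -[/IH[]].
- move=> L Q1 Q2 {}l {}Q' d IH m Q'' d'.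
  by dependent destruction d' => //= -[/IH[]].
- move=> {}Q H {}l {}Q' d IH m Q'' d'.
  by dependent destruction d' => /= /IH[].
- move=> {}Q phi {}l {}Q' d IH m Q'' d'.
  by dependent destruction d' => /= /IH[].
- move=> X {}Q {}l {}Q' d IH m Q'' d'.
  by dependent destruction d' => /= /IH[].
Qed.

Lemma sync_free_isubst X N P :
  sync_free N -> sync_free P -> sync_free (isubst X N P).
Proof.
move=> sfN; elim: P => //=.
- by move=> P1 IH1 P2 IH2 [/IH1 ? /IH2 ?].
- by move=> L P1 IH1 P2 IH2 [-> /IH1 ? /IH2 ?].
- by move=> Y _; case: eqVneq.
- by move=> Y P IH sfP; case: eqVneq => _ //=; apply: IH.
Qed.

(** Absence of synchronization excludes [ider_sync], whose path forgets both premises. Side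
    conditions agree by proof irrelevance. The two hiding rules leave no trace in the path, but they
    have contradictory side conditions on a name already identified by induction. *)
Lemma ipath_inj P a l P' (d : ider P a l P') b m P'' (d' : ider P b m P'') :
  sync_free P -> ipath d = ipath d' -> isame d d'.
Proof.
have n0 c : ~ ([set Some x | x in @set0 V]) c by rewrite image_set0.
move=> + +; elim: d b m P'' d'.
- by move=> {}a {}l {}P b m P'' d'; dependent destruction d'.
- move=> P1 P2 {}a {}l {}P' d IH b m P'' d' /= [sf1 sf2].
  by dependent destruction d' => //= -[/(IH _ _ _ _ sf1)[]].
- move=> P1 P2 {}a {}l {}P' d IH b m P'' d' /= [sf1 sf2].
  by dependent destruction d' => //= -[/(IH _ _ _ _ sf2)[]].
- move=> L P1 P2 {}a {}l {}P' h d IH b m P'' d' /= [L0 sf1 sf2].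
  dependent destruction d' => //= -[/(IH _ _ _ _ sf1) s].
  by case: s n => h'; rewrite (Prop_irrelevance h h').
- move=> L P1 P2 {}a {}l {}P' h d IH b m P'' d' /= [L0 sf1 sf2].
  dependent destruction d' => //= -[/(IH _ _ _ _ sf2) s].
  by case: s n => h'; rewrite (Prop_irrelevance h h').
- move=> L P1 P2 {}a l1 l2 P1' P2' h ? ? ? ? ? ? ? ? /= [L0].
  exfalso; move: h; rewrite L0; exact: n0.
- move=> {}P H {}a {}l {}P' h d IH b m P'' d' /= sf.
  dependent destruction d' => //= /(IH _ _ _ _ sf) s.
    by case: s i => h'; rewrite (Prop_irrelevance h h').
  by case: s n => h'.
- move=> {}P H {}a {}l {}P' h d IH b m P'' d' /= sf.
  dependent destruction d' => //= /(IH _ _ _ _ sf) s.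
    by case: s i => h'.
  by case: s n => h'; rewrite (Prop_irrelevance h h').
- move=> {}P phi {}a {}l {}P' d IH b m P'' d' /= sf.
  by dependent destruction d' => /= /(IH _ _ _ _ sf)[].
- move=> X {}P {}a {}l {}P' d IH b m P'' d' /= sf.
  by dependent destruction d' => /= /IH[]//; apply: sync_free_isubst.
Qed.

Lemma itrans_ipath_inj P a (t t' : itrans otimes P a) : sync_free P ->
  ipath (itder t) = ipath (itder t') -> t = t'.
Proof.
case: t t' => l P' d [m P'' d'] /= sf /(ipath_inj sf) s.
by dependent destruction s.
Qed.

Lemma otrans_opath_inj Q (t t' : otrans Q) :
  opath (otder t) = opath (otder t') -> t = t'.
Proof. by case: t t' => l Q' d [m Q'' d'] /= /opath_inj []. Qed.

(** * Correspondence of derivations and equality of rates *)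

Hypothesis Relab_tau : forall phi, Relab phi -> phi @^-1` [set tau] = [set tau].

(** The name lost by a time transition is recovered from its target, which is pending on it; the
    path is recorded to make the correspondence invertible. *)
Lemma oder_ider Q l K (d : oder Q l K) : oproc Q -> Gamma_image Q ->
  exists a G (d' : ider (unGamma Q) a l (unGamma G)),
    pending K a G /\ ipath d' = opath d.
Proof.
have n0 c : ~ ([set Some x | x in @set0 V]) c by rewrite image_set0.
elim: d.
- move=> {}l {}Q pQ /Gamma_image_time[Z [a [G [E ZG imG]]]]; subst Q.
  exists a, G, (ider_pre _ _ _ _); split=> //; apply: pending_wait => //.
  exact/(oproc_wait a ZG).
- move=> Q1 Q2 {}l {}K d IH /oproc_sum[p1 p2] [im1 im2].
  have [a [G [d' [pend e]]]] := IH p1 im1.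
  by exists a, G, (ider_suml _ d'); split=> //=; rewrite e.
- move=> Q1 Q2 {}l {}K d IH /oproc_sum[p1 p2] [im1 im2].
  have [a [G [d' [pend e]]]] := IH p2 im2.
  by exists a, G, (ider_sumr _ d'); split=> //=; rewrite e.
- move=> L Q1 Q2 {}l {}K d IH /oproc_par[p1 p2] [L0 im1 im2]; subst L.
  have [a [G [d' [pend e]]]] := IH p1 im1.
  exists a, (OPar set0 G Q2), (ider_parl _ (n0 a) d').
  by split=> /=; [exact: pending_parl|rewrite e].
- move=> L Q1 Q2 {}l {}K d IH /oproc_par[p1 p2] [L0 im1 im2]; subst L.
  have [a [G [d' [pend e]]]] := IH p2 im2.
  exists a, (OPar set0 Q1 G), (ider_parr _ (n0 a) d').
  by split=> /=; [exact: pending_parr|rewrite e].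
- move=> {}Q H {}l {}K d IH pQ imQ.
  have [a [G [d' [pend e]]]] := IH pQ imQ.
  have := pending_hide H pend; rewrite /hide_name; case: (pselect ((Some @` H) a)) => h ?.
    by exists tau, (OHide G H), (ider_hide_in h d').
  by exists a, (OHide G H), (ider_hide_out h d').
- move=> {}Q phi {}l {}K d IH pQ imQ.
  have [a [G [d' [pend e]]]] := IH pQ imQ.
  exists (val phi a), (ORel G phi), (ider_rel phi d').
  by split=> //; apply: pending_rel.
- move=> X {}Q {}l {}K d IH pQ imQ.
  have := IH (oproc_unfold pQ) (Gamma_image_unfold pQ imQ).
  rewrite unGamma_osubst//; last by case: pQ.
  by move=> [a [G [d' [pend e]]]]; exists a, G, (ider_unfold d').
Qed.

(** Converse of [oder_ider]. Letting [Q] be any term that decodes to [P] lets the induction pass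
    through unfolding, which need not preserve the choice of bound variables. *)
Lemma ider_oder P a l P' (d : ider P a l P') Q : oproc Q -> Gamma_image Q ->
  unGamma Q = P -> exists K G (d' : oder Q l K),
    [/\ pending K a G, unGamma G = P' & opath d' = ipath d].
Proof.
(* In each case of the induction on [d], [Gamma_image_ind] serves to invert the shape of [Q]. *)
move=> + imQ; elim: d Q imQ => //=.
- move=> {}a {}l {}P; apply: Gamma_image_ind => //=.
  move=> m Z b G ZG imG _ + [ba ml <-]; rewrite {}ba {}ml => pG.
  exists (wait Z a G), G, (oder_pre _ _).
  by split=> //; apply: pending_wait => //; apply/(oproc_wait a ZG).
- move=> P1 P2 {}a {}l {}P' d IH; apply: Gamma_image_ind => //=.
  move=> Q1 Q2 im1 im2 _ _ /oproc_sum[p1 p2] [E1 E2].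
  have [K [G [d' [pend E e]]]] := IH _ im1 p1 E1.
  by exists K, G, (oder_suml _ d'); split=> //=; rewrite e.
- move=> P1 P2 {}a {}l {}P' d IH; apply: Gamma_image_ind => //=.
  move=> Q1 Q2 im1 im2 _ _ /oproc_sum[p1 p2] [E1 E2].
  have [K [G [d' [pend E e]]]] := IH _ im2 p2 E2.
  by exists K, G, (oder_sumr _ d'); split=> //=; rewrite e.
- move=> L P1 P2 {}a {}l {}P' h d IH; apply: Gamma_image_ind => //=.
  move=> Q1 Q2 im1 im2 _ _ /oproc_par[p1 p2] [<- E1 <-].
  have [K [G [d' [pend E e]]]] := IH _ im1 p1 E1.
  exists (OPar set0 K Q2), (OPar set0 G Q2), (oder_parl _ _ d').
  by split=> /=; [exact: pending_parl|rewrite E|rewrite e].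
- move=> L P1 P2 {}a {}l {}P' h d IH; apply: Gamma_image_ind => //=.
  move=> Q1 Q2 im1 im2 _ _ /oproc_par[p1 p2] [<- <- E2].
  have [K [G [d' [pend E e]]]] := IH _ im2 p2 E2.
  exists (OPar set0 Q1 K), (OPar set0 Q1 G), (oder_parr _ _ d').
  by split=> /=; [exact: pending_parr|rewrite E|rewrite e].
- move=> L P1 P2 {}a l1 l2 P1' P2' h d1 _ d2 _; apply: Gamma_image_ind => //=.
  by move=> Q1 Q2 _ _ _ _ _ [L0 _ _]; subst L; case: h.
- move=> {}P H {}a {}l {}P' h d IH; apply: Gamma_image_ind => //=.
  move=> Q H' imQ _ pQ [E HE]; subst H'.
  have [K [G [d' [pend {}E e]]]] := IH _ imQ pQ E.
  exists (OHide K H), (OHide G H), (oder_hide _ d').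
  split=> //=; last by rewrite E.
  by have := pending_hide H pend; rewrite /hide_name; case: (pselect ((Some @` H) a)).
- move=> {}P H {}a {}l {}P' h d IH; apply: Gamma_image_ind => //=.
  move=> Q H' imQ _ pQ [E HE]; subst H'.
  have [K [G [d' [pend {}E e]]]] := IH _ imQ pQ E.
  exists (OHide K H), (OHide G H), (oder_hide _ d').
  split=> //=; last by rewrite E.
  by have := pending_hide H pend; rewrite /hide_name; case: (pselect ((Some @` H) a)).
- move=> {}P phi {}a {}l {}P' d IH; apply: Gamma_image_ind => //=.
  move=> Q phi' imQ _ pQ [E HE]; subst phi'.
  have [K [G [d' [pend {}E e]]]] := IH _ imQ pQ E.
  exists (ORel K phi), (ORel G phi), (oder_rel _ d').
  by split=> //=; [exact: pending_rel|rewrite E].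
- move=> X {}P {}a {}l {}P' d IH; apply: Gamma_image_ind => //=.
  move=> Y Q imQ _ pQ [YX E]; subst Y.
  have [|K [G [d' [pend {}E e]]]] := IH _ (Gamma_image_unfold pQ imQ) (oproc_unfold pQ).
    by rewrite unGamma_osubst //=; [rewrite E|case: pQ].
  by exists K, G, (oder_unfold d').
Qed.

(** Among the targets, which are all pending, [D] selects those pending on [a] with a continuation
    decoding into [D']; the sums then agree along the bijection of derivations. *)
Lemma orate_unGamma Q a (D : set oterm) (D' : set iterm) :
  oproc Q -> Gamma_image Q ->
  (forall K b G, pending K b G -> D K <-> b = a /\ D' (unGamma G)) ->
  orate Q D = irate otimes (unGamma Q) a D'.
Proof.
move=> pQ imQ DD'.
have /choice[e eP] (t : itrans otimes (unGamma Q) a) : exists t' : otrans Q,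
    [/\ otrate t' = itrate t, opath (otder t') = ipath (itder t) &
        D (ottarget t') <-> D' (ittarget t)].
  have [K [G [d' [pend E e]]]] := ider_oder (itder t) pQ imQ erefl.
  exists (OTrans d'); split=> //=.
  by rewrite (DD' _ _ _ pend) E; split=> [[]|].
rewrite /orate /irate (@reindex_esum _ _ _ [set t | D' (ittarget t)] _ e).
  by apply: eq_esum => t _; have [Er _ _] := eP t; rewrite Er.
(* [e] preserves paths, and paths determine transitions on both sides: this gives injectivity and
   surjectivity. *)
split=> [t /= D't|t t' _ _ ett'|t /= Dt].
- by have [_ _ DD't] := eP t; apply/DD't.
- have [_ Et _] := eP t; have [_ Et' _] := eP t'.
  apply: itrans_ipath_inj; first exact: sync_free_unGamma.
  by rewrite -Et -Et' ett'.
- have [b [G [d' [pend E]]]] := oder_ider (otder t) pQ imQ.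
  have [ba D'G] := (DD' _ _ _ pend).1 Dt; subst b.
  exists (ITrans d') => //; apply: otrans_opath_inj.
  by have [_ -> _] := eP (ITrans d').
Qed.

Lemma orate_unGamma0 Q (D : set oterm) : oproc Q -> Gamma_image Q ->
  (forall K b G, pending K b G -> ~ D K) -> orate Q D = 0%E.
Proof.
move=> pQ imQ D0; apply: esum1 => t /= Dt.
by have [b [G [d [/D0]]]] := oder_ider (otder t) pQ imQ.
Qed.

End Derivations.

(** * Equivalence closures and sums over partitions *)

Inductive equiv_closure (T : Type) (A : set T) (S : T -> T -> Prop) :
    T -> T -> Prop :=
| equiv_closure_base x y : A x -> A y -> S x y -> equiv_closure A S x y
| equiv_closure_refl x : A x -> equiv_closure A S x x
| equiv_closure_sym x y : equiv_closure A S x y -> equiv_closure A S y x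
| equiv_closure_trans x y z : equiv_closure A S x y -> equiv_closure A S y z ->
    equiv_closure A S x z.

Lemma equiv_closure_equivalence (T : Type) (A : set T) (S : T -> T -> Prop) :
  equivalence_on A (equiv_closure A S).
Proof.
split; [|exact: equiv_closure_refl|exact: equiv_closure_sym|exact: equiv_closure_trans].
by move=> x y; elim=> // [{}x {}y _ [] //|{}x {}y z _ [? _] _ [_ ?]].
Qed.

(** Sums along the fibres of [c]; an index of [K] that is not attained contributes an empty sum. *)
Lemma esum_partition (R : realType) (T I : choiceType) (A : set T) (K : set I)
    (c : T -> I) (f : T -> \bar R) :
  (forall t, (0 <= f t)%E) -> (forall t, A t -> K (c t)) ->
  (\esum_(t in A) f t = \esum_(k in K) \esum_(t in [set t | A t /\ c t = k]) f t)%E.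
Proof.
move=> f0 AK; rewrite esum_esum//; apply: reindex_esum; split.
- by move=> [k t] [_ []].
- by move=> [k t] [k' t']; rewrite !inE /= => -[_ [_ <-]] [_ [_ <-]] ->.
- by move=> t At; exists (c t, t) => //; split=> //; exact: AK.
Qed.

(** * Maximal-progress bisimilarity as a bisimulation, and its behaviour on pending terms *)

Section OtBisimilarity.
Variables (R : realType) (V : Type) (Var : eqType).
Variable Relab : set (name V -> name V).
Local Notation oterm := (oterm R Var Relab).
Local Notation oproc := (@oproc R V Var Relab).
Local Notation ombisimilar_mp := (@ombisimilar_mp R V Var Relab).
Implicit Types (Q G K : oterm) (a b : name V).

Lemma oact_oproc Q a Q' : oact Q a Q' -> oproc Q -> oproc Q'.
Proof.
elim=> //.
- by move=> Q1 Q2 {}a {}Q' _ IH /oproc_sum[/IH].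
- by move=> Q1 Q2 {}a {}Q' _ IH /oproc_sum[_ /IH].
- by move=> L Q1 Q2 {}a {}Q' _ _ IH /oproc_par[/IH ? ?]; apply/oproc_par.
- by move=> L Q1 Q2 {}a {}Q' _ _ IH /oproc_par[? /IH ?]; apply/oproc_par.
- move=> L Q1 Q2 {}a Q1' Q2' _ _ IH1 _ IH2 /oproc_par[/IH1 ? /IH2 ?].
  exact/oproc_par.
- by move=> X {}Q {}a {}Q' _ IH /oproc_unfold.
Qed.

(** A saturated [D] is a disjoint union of classes of [E], and rates add up over the classes it
    contains. *)
Lemma orate_saturated (E : oterm -> oterm -> Prop) (D : set oterm) Q1 Q2 :
  equivalence_on oproc E -> D `<=` oproc -> (forall x y, D x -> E x y -> D y) ->
  (forall C, quotient_set oproc E C -> orate Q1 C = orate Q2 C) ->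
  orate Q1 D = orate Q2 D.
Proof.
move=> [Ep Er Es Et] Dp Dsat rateC.
pose KD := [set C | quotient_set oproc E C /\ C `<=` D].
suff orateE Q : orate Q D = (\esum_(C in KD) orate Q C)%E.
  by rewrite !orateE; apply: eq_esum => C [/rateC].
rewrite /orate (@esum_partition _ _ _ _ KD (fun t => [set y | E (ottarget t) y])).
- apply: eq_esum => C [[x px <-] CD]; congr (esum _ _); apply/seteqP; split=> t /=.
    by move=> [/Dp /Er Ett cE]; have : [set y | E x y] (ottarget t) by rewrite -cE.
  move=> Ext; split; first exact: CD.
  by apply/seteqP; split => y /=; [exact: Et|apply: Et; exact: Es].
- by move=> t; rewrite lee_fin.
- move=> t Dt; split; first by exists (ottarget t) => //; exact: Dp.
  by move=> y; exact: Dsat.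
Qed.

Definition ot_stable Q : Prop := ~ (exists Q', oact Q tau Q').

Definition ot_matching (E : oterm -> oterm -> Prop) Q1 Q2 : Prop :=
  [/\ forall a Q1', oact Q1 a Q1' -> exists2 Q2', oact Q2 a Q2' & E Q1' Q2',
      forall a Q2', oact Q2 a Q2' -> exists2 Q1', oact Q1 a Q1' & E Q1' Q2' &
      ot_stable Q1 -> ot_stable Q2 ->
      forall D : set oterm, quotient_set oproc E D -> orate Q1 D = orate Q2 D].

(** The transfer conditions, stated for the closure itself, are stable under symmetry and
    transitivity, so they need checking on generating pairs only. *)
Lemma ombisim_equiv_closure (S : oterm -> oterm -> Prop) :
  (forall Q1 Q2, oproc Q1 -> oproc Q2 -> S Q1 Q2 ->
     ot_matching (equiv_closure oproc S) Q1 Q2) ->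
  ombisim_mp (equiv_closure oproc S).
Proof.
move=> SE; have eqE := equiv_closure_equivalence oproc S; split=> //.
move: eqE SE; set E := equiv_closure oproc S => -[Ep Er Es Et] SE.
move=> Q1 Q2; elim=> {Q1 Q2} [Q1 Q2|Q pQ|Q1 Q2 _ [act12 act21 rate12]|].
- exact: SE.
- by split=> // a Q' QQ'; exists Q' => //; apply: Er; apply: oact_oproc QQ' pQ.
- split=> [a Q'|a Q'|st2 st1 D ED].
  + by move=> /act21[Q'' ? /Es ?]; exists Q''.
  + by move=> /act12[Q'' ? /Es ?]; exists Q''.
  + by rewrite rate12.
- move=> Q1 Q2 Q3 _ [act12 act21 rate12] _ [act23 act32 rate23].
  split=> [a Q1'|a Q3'|st1 st3 D ED].
  + move=> /act12[Q2' /act23[Q3' ? E23] E12].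
    by exists Q3' => //; apply: Et E12 E23.
  + move=> /act32[Q2' /act21[Q1' ? E12] E23].
    by exists Q1' => //; apply: Et E12 E23.
  (* Rates are compared through [Q2] only if it is stable too; it is, since [Q1] would have to match
     any [tau] of [Q2]. *)
  + have st2 : ot_stable Q2 by move=> [Q2' /act21[Q1' ? _]]; apply: st1; exists Q1'.
    by rewrite rate12// rate23.
Qed.

Lemma quotient_set_sub (E : oterm -> oterm -> Prop) D :
  equivalence_on oproc E -> quotient_set oproc E D ->
  D `<=` oproc /\ (forall x y, D x -> E x y -> D y).
Proof.
move=> [Ep Er Es Et] [x px <-]; split=> [y /= /Ep[]//|y z /=]; exact: Et.
Qed.

(** Classes of the coarser [E] are saturated for [B], so equality of rates on classes of [B] carries
    over. *)
Lemma ombisim_matching_sub (B E : oterm -> oterm -> Prop) Q1 Q2 :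
  equivalence_on oproc E -> (forall x y, B x y -> E x y) ->
  ombisim_mp B -> B Q1 Q2 -> ot_matching E Q1 Q2.
Proof.
move=> eqE BE [eqB matchB] /matchB[act12 act21 rate12]; split.
- by move=> a Q' /act12[Q'' ? /BE ?]; exists Q''.
- by move=> a Q' /act21[Q'' ? /BE ?]; exists Q''.
- move=> st1 st2 D /(quotient_set_sub eqE)[Dp Dsat].
  apply: (@orate_saturated B) => //; last exact: rate12.
  by move=> x y Dx /BE; exact: Dsat.
Qed.

Lemma ombisimilar_mp_oproc Q1 Q2 : ombisimilar_mp Q1 Q2 -> oproc Q1 /\ oproc Q2.
Proof. by move=> [B [[Bp _ _ _] _] /Bp]. Qed.

(** A union of equivalences need not be transitive, so its equivalence closure is shown to be a
    bisimulation; it is then contained in the union, and equal to it. *)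
Lemma ombisim_ombisimilar_mp : ombisim_mp ombisimilar_mp.
Proof.
have bisimE : ombisim_mp (equiv_closure oproc ombisimilar_mp).
  apply: ombisim_equiv_closure => Q1 Q2 _ _ [B bisB].
  apply: ombisim_matching_sub => //; first exact: equiv_closure_equivalence.
  move=> x y Bxy; have xy : ombisimilar_mp x y by exists B.
  by have [px py] := ombisimilar_mp_oproc xy; apply: equiv_closure_base.
suff -> : ombisimilar_mp = equiv_closure oproc ombisimilar_mp by [].
apply/funext => Q1; apply/funext => Q2; apply/propext; split=> [s|E12].
  by have [p1 p2] := ombisimilar_mp_oproc s; apply: equiv_closure_base.
by exists (equiv_closure oproc ombisimilar_mp).
Qed.

(** Such pairs can be added to bisimilarity: the loops answer each other, the other steps lead to
    [G] and [G'], and no rate is compared as neither side is stable. *)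
Lemma pending_bisimilar K a G K' G' : pending K a G -> pending K' a G' ->
  ombisimilar_mp G G' -> ombisimilar_mp K K'.
Proof.
pose S x y := ombisimilar_mp x y \/ exists a G G',
  [/\ pending x a G, pending y a G' & ombisimilar_mp G G'].
move=> pend pend' GG'; exists (equiv_closure oproc S); last first.
  case: (pend) (pend') => pK _ _ _ [pK' _ _ _].
  by apply: equiv_closure_base => //; right; exists a, G, G'.
apply: ombisim_equiv_closure => Q1 Q2 p1 p2.
have eqE := equiv_closure_equivalence oproc S.
have simE x y : ombisimilar_mp x y -> equiv_closure oproc S x y.
  move=> xy; have [px py] := ombisimilar_mp_oproc xy.
  by apply: equiv_closure_base => //; left.
move=> S12; have E12 : equiv_closure oproc S Q1 Q2 by exact: equiv_closure_base.
case: S12 => [s|[b [H [H' [[_ _ _ act1] [_ _ _ act2] HH']]]]].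
  exact: ombisim_matching_sub ombisim_ombisimilar_mp s.
split=> [c Q'|c Q'|st1].
- move=> /act1[[-> ->]|[-> ->]]; first by exists Q2 => //; apply/act2; left.
  by exists H'; [apply/act2; right|exact: simE].
- move=> /act2[[-> ->]|[-> ->]]; first by exists Q1 => //; apply/act1; left.
  by exists H; [apply/act1; right|exact: simE].
- by exfalso; apply: st1; exists Q1; apply/act1; left.
Qed.

Lemma bisimilar_pending K a G K' b G' : pending K a G -> pending K' b G' ->
  ombisimilar_mp K K' -> a = b /\ ombisimilar_mp G G'.
Proof.
move=> pend [pK' pG' imG' act'] KK'; have [pK pG imG act] := pend.
have [eqs matchs] := ombisim_ombisimilar_mp; have [_ _ ss _] := eqs.
have [_ act21 _] := matchs _ _ KK'.
have [Q' /act + Q'G'] : exists2 Q', oact K b Q' & ombisimilar_mp Q' G'.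
  by apply: act21; apply/act'; right.
(* [K] cannot answer by its loop: it would then be bisimilar to [G'], which is translated and cannot
   match the [tau] of [K]. *)
case=> [[_ E]|[-> E]]; subst Q' => //; exfalso.
have [+ _ _] := matchs _ _ Q'G'; move=> /(_ tau K)[|Q'' G'Q'' _].
  by apply/act; left.
exact: Gamma_image_noact pG' imG' G'Q''.
Qed.

End OtBisimilarity.

(** * Preservation and reflection of bisimilarity by the translation *)

Section Correctness.
Variables (R : realType) (V : Type) (Var : eqType).
Variable Relab : set (name V -> name V).
Variable otimes : {posnum R} -> {posnum R} -> {posnum R}.
Hypothesis Relab_tau : forall phi, Relab phi -> phi @^-1` [set tau] = [set tau].
Local Notation iterm := (iterm R Var Relab).
Local Notation oterm := (oterm R Var Relab).
Local Notation oproc := (@oproc R V Var Relab).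
Local Notation iproc := (@iproc R V Var Relab).
Local Notation ombisimilar_mp := (@ombisimilar_mp R V Var Relab).
Implicit Types (P : iterm) (Q G K : oterm) (a b : name V).

Lemma ombisimilar_mp_unGamma (B : iterm -> iterm -> Prop) Q1 Q2 :
  imbisim otimes B -> Gamma_image Q1 -> Gamma_image Q2 ->
  B (unGamma Q1) (unGamma Q2) -> ombisimilar_mp Q1 Q2.
Proof.
move=> [[Bp Br Bs Bt] rateB] im1 im2 B12.
(* Equality makes the relation reflexive on all of [oproc]; the other two clauses carry [B] to
   translated and to pending terms. *)
pose S x y := [\/ x = y,
  [/\ Gamma_image x, Gamma_image y & B (unGamma x) (unGamma y)] |
  exists a G G', [/\ pending x a G, pending y a G' & B (unGamma G) (unGamma G')]].
have p12 : oproc Q1 /\ oproc Q2 by rewrite -!iproc_unGamma//; exact: Bp.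
exists (fun x y => [/\ oproc x, oproc y & S x y]); last first.
  by case: p12; split=> //; constructor 2.
have SG x y : Gamma_image x -> Gamma_image y -> B (unGamma x) (unGamma y) ->
    [/\ oproc x, oproc y & S x y].
  move=> imx imy Bxy; have [px py] := Bp _ _ Bxy; split; last by constructor 2.
    by rewrite -iproc_unGamma.
  by rewrite -iproc_unGamma.
split; first split.
- by move=> x y [].
- by move=> x px; split=> //; constructor 1.
- move=> x y [px py Sxy]; split=> //.
  case: Sxy => [->|[imx imy /Bs ?]|[a [G [G' [pendx pendy /Bs ?]]]]].
  + by constructor 1.
  + by constructor 2.
  + by constructor 3; exists a, G', G.
- move=> x y z [px py Sxy] [_ pz Syz]; split=> //.
  (* The mixed cases are void, as a pending term is never translated; two pending pairs compose
     because the middle term determines its name and continuation. *)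
  case: Sxy Syz => [->//|[imx imy Bxy]|[a [G [G' [pendx pendy BG]]]]]
    [<-|[imy' imz Byz]|[b [H [H' [pendy' pendz BH]]]]].
  + by constructor 2.
  + by constructor 2; split=> //; exact: Bt Bxy Byz.
  + by have := pending_not_image pendy' imy.
  + by constructor 3; exists a, G, G'.
  + by have := pending_not_image pendy imy'.
  + have [ab GH] := pending_inj pendy pendy'; subst b H.
    by constructor 3; exists a, G, H'; split=> //; exact: Bt BG BH.
move=> {Q1 Q2 im1 im2 B12 p12} Q1 Q2 [p1 p2 S12].
case: (S12) => [->|[im1 im2 B12]|[a [G [G' [[? ? imG act1] [? ? imG' act2] BG]]]]].
- split=> // a Q' act; exists Q' => //; have pQ' := oact_oproc act p2.
    by split=> //; constructor 1.
  by split=> //; constructor 1.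
- split=> [a Q' /(Gamma_image_noact p1 im1)//
    |a Q' /(Gamma_image_noact p2 im2)//|_ _ D [K0 pK0 <-]].
  (* Time transitions reach pending terms only. If [K0] is not pending, its class contains none and
     both rates vanish; otherwise its class stands for a name together with a class of [B]. *)
  have [[a [G0 pend0]]|npend0] := pselect (exists a G, pending K0 a G); last first.
    suff D0 K b G : pending K b G -> ~ [/\ oproc K0, oproc K & S K0 K].
      by rewrite !(orate_unGamma0 otimes Relab_tau).
    move=> pend [_ _]; case=> [E|[_ imK _]|[c [G0 [G1 [pend0 _ _]]]]].
    + by apply: npend0; exists b, G; rewrite E.
    + exact: pending_not_image pend imK.
    + by apply: npend0; exists c, G0.
  have pG0 : iproc (unGamma G0) by case: pend0 => _ ? ? _; rewrite iproc_unGamma.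
  have classE K b G : pending K b G ->
      [/\ oproc K0, oproc K & S K0 K] <-> b = a /\ B (unGamma G0) (unGamma G).
    move=> pend; split=> [[_ _]|[ba BG]].
      case=> [E|[_ imK _]|[c [G1 [G2 [pend1 pend2 B12']]]]].
      + by subst K; have [-> ->] := pending_inj pend pend0; split=> //; exact: Br.
      + by have := pending_not_image pend imK.
      + have [-> ->] := pending_inj pend pend2.
        by have [-> ->] := pending_inj pend0 pend1.
    subst b; split=> //; first by case: pend.
    by constructor 3; exists a, G0, G.
  rewrite !(orate_unGamma otimes Relab_tau (a := a) (D' := [set P | B (unGamma G0) P]))//.
  by apply: rateB => //; exists (unGamma G0).
- split=> [b Q'|b Q'|st1].
  + move=> /act1[[-> ->]|[-> ->]]; first by exists Q2 => //; apply/act2; left.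
    by exists G'; [apply/act2; right|exact: SG].
  + move=> /act2[[-> ->]|[-> ->]]; first by exists Q1 => //; apply/act1; left.
    by exists G; [apply/act1; right|exact: SG].
  + by exfalso; apply: st1; exists Q1; apply/act1; left.
Qed.

(** Equality is itself an integrated-time bisimulation, so the choice of the variables [Z] is
    immaterial up to bisimilarity. *)
Lemma ombisimilar_mp_alpha Q1 Q2 : oproc Q1 -> Gamma_image Q1 ->
  Gamma_image Q2 -> unGamma Q1 = unGamma Q2 -> ombisimilar_mp Q1 Q2.
Proof.
move=> p1 im1 im2 E; apply: (@ombisimilar_mp_unGamma (fun x y => iproc x /\ x = y)) => //.
  split; first by split=> [x y [+ <-]|//|x y [+ <-]|x y z [? <-]].
  by move=> P _ [_ <-].
by rewrite -E iproc_unGamma.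
Qed.

Lemma imbisimilar_Gamma_mp fresh P1 P2 : (forall P, fresh P \notin ifv P) ->
  iproc P1 -> iproc P2 -> sync_free P1 -> sync_free P2 ->
  ombisimilar_mp (Gamma_mp fresh P1) (Gamma_mp fresh P2) ->
  imbisimilar otimes P1 P2.
Proof.
move=> freshP p1 p2 sf1 sf2 s12.
pose Gm := Gamma_mp fresh.
have imG P : sync_free P -> Gamma_image (Gm P) by case/(Gamma_image_Gamma_mp freshP).
have GmK P : sync_free P -> unGamma (Gm P) = P by case/(Gamma_image_Gamma_mp freshP).
have pG P : iproc P -> sync_free P -> oproc (Gm P).
  by move=> pP sfP; rewrite -iproc_unGamma ?GmK//; exact: imG.
have [[_ sr ss st] _] := @ombisim_ombisimilar_mp R V Var Relab.
(* Bisimilarity pulled back along the translation; equality makes [B] reflexive also on terms with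
   synchronization. *)
pose B x y := [/\ iproc x, iproc y &
  x = y \/ [/\ sync_free x, sync_free y & ombisimilar_mp (Gm x) (Gm y)]].
exists B; last by split=> //; right.
split; first split.
- by move=> x y [].
- by move=> x px; split=> //; left.
- by move=> x y [px py [->|[? ? /ss ?]]]; split=> //; [left|right].
- move=> x y z [px py xy] [_ pz yz]; split=> //.
  case: xy yz => [->//|[sfx sfy xy]] [<-|[_ sfz yz]]; right=> //.
  by split=> //; exact: st xy yz.
have rateG P a (D : set iterm) (D' : set oterm) : iproc P -> sync_free P ->
    (forall K b G, pending K b G -> D' K <-> b = a /\ D (unGamma G)) ->
    irate otimes P a D = orate (Gm P) D'.
  move=> pP sfP DD'; rewrite -{1}(GmK _ sfP).
  by apply/esym; apply: orate_unGamma => //; [exact: pG|exact: imG].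
move=> {P1 P2 p1 p2 sf1 sf2 s12} P1 P2 [p1 p2 [->//|[sf1 sf2 s12]]] a D [P0 p0 <-].
(* If [P0] has synchronization, its class is [P0] alone. Continuations of synchronization-free terms
   are synchronization-free, so both rates equal the rate into the empty set. *)
have [sf0|nsf0] := pselect (sync_free P0); last first.
  suff B0 K b G : pending K b G -> set0 K <-> b = a /\ B P0 (unGamma G).
    rewrite !(rateG _ _ _ set0)//.
    by rewrite /orate !esum1.
  move=> [_ _ imG' _]; split=> // -[_ [_ _ [E|[]//]]]; apply: nsf0.
  by rewrite E; exact: sync_free_unGamma.
(* The bisimilarity class of this term encodes the name [a] together with the class of [P0], so the
   rates into it are those sought. *)
have pend0 : pending (wait (fresh P0) a (Gm P0)) a (Gm P0).
  apply: pending_wait; [exact: pG|exact: imG|].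
  by rewrite -ifv_unGamma ?GmK//; exact: imG.
set K0 := wait _ _ _ in pend0.
suff BE K b G : pending K b G ->
    [set K | ombisimilar_mp K0 K] K <-> b = a /\ B P0 (unGamma G).
  rewrite !(rateG _ _ _ [set K | ombisimilar_mp K0 K])//.
  have [_ /(_ _ _ s12)[_ _]] := @ombisim_ombisimilar_mp R V Var Relab.
  apply; last by exists K0 => //; case: pend0.
    by move=> [Q]; apply: Gamma_image_noact; [exact: pG|exact: imG].
  by move=> [Q]; apply: Gamma_image_noact; [exact: pG|exact: imG].
move=> pend; have [_ pG' imG' _] := pend.
have sfG := sync_free_unGamma imG'.
have pG0 : iproc (unGamma G) by rewrite iproc_unGamma.
(* A continuation [G] may use other bound variables than [Gm] chooses, so it is only bisimilar to
   the translation of its decoding. *)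
have simG : ombisimilar_mp (Gm (unGamma G)) G.
  by apply: ombisimilar_mp_alpha; [exact: pG|exact: imG|by []|exact: GmK].
split=> [/(bisimilar_pending pend0 pend)[-> s]|[ba [_ _ BG]]].
  by split=> //; split=> //; right; split=> //; exact: st s (ss _ _ simG).
subst b; apply: (pending_bisimilar pend0 pend).
by case: BG => [->//|[_ _ s]]; exact: st s simG.
Qed.

End Correctness.

Theorem theorem3 (R : realType) (V : Type) (Var : eqType)
    (Relab : set (name V -> name V))
    (Relab_tau : forall phi, Relab phi -> phi @^-1` [set tau] = [set tau])
    (otimes : {posnum R} -> {posnum R} -> {posnum R})
    (otimesA : associative otimes) (otimesC : commutative otimes)
    (fresh : iterm R Var Relab -> Var)
    (freshP : forall P, fresh P \notin ifv P)
    (P1 P2 : iterm R Var Relab) :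
  iproc P1 -> iproc P2 -> sync_free P1 -> sync_free P2 ->
  imbisimilar otimes P1 P2 <->
  ombisimilar_mp (Gamma_mp fresh P1) (Gamma_mp fresh P2).
Proof.
move=> p1 p2 sf1 sf2; split; last exact: imbisimilar_Gamma_mp.
have [im1 E1] := Gamma_image_Gamma_mp freshP sf1.
have [im2 E2] := Gamma_image_Gamma_mp freshP sf2.
move=> [B bisB B12]; apply: (ombisimilar_mp_unGamma Relab_tau bisB) => //.
by rewrite E1 E2.
Qed.
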